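(* Let design data be given, and suppose that the parameter sets are endowed with measurable structures for which the reparametrisation maps are measurable, i.e. that $U_{\mathsf K}\circ\Theta:\mathsf\Omega^{\mathrm{op}}\to\mathsf{Set}$ lifts to a functor $\Theta_{\mathsf{Meas}}:\mathsf\Omega^{\mathrm{op}}\to\mathsf{Meas}$ with $|\cdot|\circ\Theta_{\mathsf{Meas}}=U_{\mathsf K}\circ\Theta$. Let $L,R:\mathsf V\times\mathsf D^{\mathrm{op}}\to\mathsf{Set}$ and $\mathbf L,\mathbf R:\mathsf V\times\mathsf D^{\mathrm{op}}\to\mathsf{Stoch}$ be the functors defined in the context. Then: (i) Sending $P$ to the family $\mathbf P$ of kernels $\mathbf P_{v,d}:\theta\mapsto P_{v,d}(\,\cdot\mid\theta)$ is a bijection between the statistical models $P:L\Rightarrow R$ whose components are measurable in the parameter and the natural transformations $\mathbf P:\mathbf L\Rightarrow\mathbf R$. (ii) The morphisms $\mathbf L(m)$ and $\mathbf R(m)$ of $\mathsf{Stoch}$ are deterministic for every morphism $m$ of $\mathsf V\times\mathsf D^{\mathrm{op}}$. (iii) If the design data are finite (and the parameter sets carry the discrete $\sigma$-algebra), then every statistical model $P:L\Rightarrow R$ has measurable components, and $\mathsf{Stoch}$ can be replaced by $\mathsf{FinStoch}$: the functors $\mathbf L,\mathbf R$ take values in $\mathsf{FinStoch}$ and $P\mapsto\mathbf P$ is a bijection between all statistical models $P:L\Rightarrow R$ and the natural transformations $\mathbf L\Rightarrow\mathbf R$ of functors $\mathsf V\times\mathsf D^{\mathrm{op}}\to\ma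thsf{FinStoch}$.
   Context: All categories are locally small. $\mathsf{Set}$ is the category of sets, $\mathsf{Meas}$ the category of measurable spaces and measurable maps, $|\cdot|:\mathsf{Meas}\to\mathsf{Set}$ the forgetful functor. $\mathcal P:\mathsf{Meas}\to\mathsf{Set}$ sends a space to the set of its probability measures and a measurable map to the pushforward. $\mathsf{Stoch}$ has the measurable spaces as objects and the Markov kernels $k:X\rightsquigarrow Y$ as morphisms ($k(x)$ is a probability measure on $Y$ and $x\mapsto k(x)(B)$ is measurable for every measurable $B$), with composition $(k'\circ k)(x)(C)=\int_Y k'(y)(C)\,k(x)(\mathrm dy)$. $\mathsf{FinStoch}$ is its full subcategory of the finite discrete spaces (morphisms are stochastic matrices). A kernel $f:X\rightsquigarrow Y$ is deterministic if $f(x)(B)\in\{0,1\}$ for all $x\in X$ and all measurable $B\subseteq Y$ (equivalently, it is a homomorphism of the copy comonoids). $\delta:\mathsf{Meas}\to\mathsf{Stoch}$ is the identity on objects and sends $f$ to the kernel $x\mapsto\delta_{f(x)}$. Design data consist of: (1) a category $\mathsf U$ (statistical units); (2) a category $\mathsf\Omega$ (covariate spaces); (3) a category $\mathsf V$ (response scales); (4) a functor $\Gamma:\mathsf V\times\mathsf U^{\mathrm{op}}\to\mathsf{Meas}$ (sample spaces); (5) functors $J_{\mathsf U}:\mathsf U\to\mathsf C$ and $J_{\mathsf\Omega}:\mathsf\Omega\to\mathsf C$ into a category $\mathsf C$; the category of designs is the comma category $\mathsf D=(J_{\mathsf U}\downarrow J_{\mathsf\Omega})$, with objects the triples $(u,\omega,x)$,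 $x:J_{\mathsf U}u\to J_{\mathsf\Omega}\omega$, and morphisms $(u,\omega,x)\to(u',\omega',x')$ the pairs $(\varphi:u\to u',\psi:\omega\to\omega')$ with $x'\circ J_{\mathsf U}\varphi=J_{\mathsf\Omega}\psi\circ x$; $\mathrm{pr}_{\mathsf U}:\mathsf D\to\mathsf U$ and $\mathrm{pr}_{\mathsf\Omega}:\mathsf D\to\mathsf\Omega$ are the projections; (6) a category $\mathsf K$ with a faithful functor $U_{\mathsf K}:\mathsf K\to\mathsf{Set}$ and a functor $\Theta:\mathsf\Omega^{\mathrm{op}}\to\mathsf K$ (parameter functor). Set $L=U_{\mathsf K}\circ\Theta\circ\mathrm{pr}_{\mathsf\Omega}^{\mathrm{op}}\circ\mathrm{pr}_2$ and $R=\mathcal P\circ\Gamma\circ(\mathrm{id}_{\mathsf V}\times\mathrm{pr}_{\mathsf U}^{\mathrm{op}})$, functors $\mathsf V\times\mathsf D^{\mathrm{op}}\to\mathsf{Set}$, where $\mathrm{pr}_2$ is the projection to $\mathsf D^{\mathrm{op}}$. A statistical model (in the sense of McCullagh and Brøns) is a natural transformation $P:L\Rightarrow R$; its component at $(v,d)$, $d=(u,\omega,x)$, is a map $P_{v,d}:U_{\mathsf K}\Theta(\omega)\to\mathcal P(\Gamma(v,u))$, $\theta\mapsto P_{v,d}(\,\cdot\mid\theta)$. Its components are measurable in the parameter if, for all $(v,d)$ and all measurable $E\subseteq\Gamma(v,u)$, the function $\theta\mapsto P_{v,d}(E\mid\theta)$ is measurable on $\Theta_{\mathsf{Meas}}(\omega)$.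 Set $\mathbf L=\delta\circ\Theta_{\mathsf{Meas}}\circ\mathrm{pr}_{\mathsf\Omega}^{\mathrm{op}}\circ\mathrm{pr}_2$ and $\mathbf R=\delta\circ\Gamma\circ(\mathrm{id}_{\mathsf V}\times\mathrm{pr}_{\mathsf U}^{\mathrm{op}})$. The design data are finite if the objects of $\mathsf V,\mathsf\Omega,\mathsf U$ have finite underlying sets, all spaces $\Gamma(v,u)$ are finite and discrete, and all sets $U_{\mathsf K}\Theta(\omega)$ are finite; each $U_{\mathsf K}\Theta(\omega)$ is then given the discrete $\sigma$-algebra, which defines $\Theta_{\mathsf{Meas}}$. *)

(* Defs.v *)
From HB Require Import structures.
From mathcomp Require Import all_boot all_order all_algebra.
From mathcomp Require Import all_classical all_reals all_analysis.
From mathcomp Require Import measurable_realfun.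

Set Implicit Arguments.
Unset Strict Implicit.
Unset Printing Implicit Defensive.

Import Order.TTheory GRing.Theory Num.Theory.
Import numFieldNormedType.Exports.

Local Open Scope classical_set_scope.
Local Open Scope ring_scope.
Local Open Scope ereal_scope.

#[local] Obligation Tactic := cbn; intros; try reflexivity.

Record category := Category {
  obj :> Type;
  mor : obj -> obj -> Type;
  idmor : forall a, mor a a;
  cmp : forall a b c, mor b c -> mor a b -> mor a c;
  cmp1m : forall a b (f : mor a b), cmp (idmor b) f = f;
  cmpm1 : forall a b (f : mor a b), cmp f (idmor a) = f;
  cmpA : forall a b c d (h : mor c d) (g : mor b c) (f : mor a b),
    cmp h (cmp g f) = cmp (cmp h g) f }.
Arguments mor {_} _ _.
Arguments idmor {_} _.
Arguments cmp {_ _ _ _} _ _.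

Notation "g \oc f" := (cmp g f) (at level 40, left associativity).

Record functor (C D : category) := Functor {
  fobj :> C -> D;
  fhom : forall a b : C, mor a b -> mor (fobj a) (fobj b);
  fhom1 : forall a, fhom (idmor a) = idmor (fobj a);
  fhomM : forall a b c (g : mor b c) (f : mor a b),
    fhom (g \oc f) = fhom g \oc fhom f }.
Arguments fhom {_ _} _ {_ _} _.

Definition faithful_functor (C D : category) (F : functor C D) :=
  forall (a b : C) (f g : mor a b), fhom F f = fhom F g -> f = g.

Record nat_trans (C D : category) (F G : functor C D) := NatTrans {
  component :> forall a, mor (F a) (G a);
  naturality : forall a b (f : mor a b),
    fhom G f \oc component a = component b \oc fhom F f }.

Program Definition functor_comp (C D E : category)
    (G : functor D E) (F : functor C D) : functor C E :=
  @Functor C E (fun a => G (F a)) (fun a b f => fhom G (fhom F f)) _ _.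
Next Obligation. by rewrite !fhom1. Qed.
Next Obligation. by rewrite !fhomM. Qed.

Program Definition op (C : category) : category :=
  @Category C (fun a b => @mor C b a) (fun a => idmor a)
    (fun a b c g f => f \oc g) _ _ _.
Next Obligation. by rewrite cmpm1. Qed.
Next Obligation. by rewrite cmp1m. Qed.
Next Obligation. by rewrite cmpA. Qed.

Program Definition op_functor (C D : category) (F : functor C D) :
    functor (op C) (op D) :=
  @Functor (op C) (op D) F (fun a b f => fhom F f) _ _.
Next Obligation. by rewrite fhom1. Qed.
Next Obligation. by rewrite fhomM. Qed.

Program Definition prod_cat (C D : category) : category :=
  @Category (C * D)%type (fun p q => (mor p.1 q.1 * mor p.2 q.2)%type)
    (fun p => (idmor p.1, idmor p.2))
    (fun p q r g f => (g.1 \oc f.1, g.2 \oc f.2)) _ _ _.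
Next Obligation. by case: f => f1 f2; rewrite !cmp1m. Qed.
Next Obligation. by case: f => f1 f2; rewrite !cmpm1. Qed.
Next Obligation. by rewrite !cmpA. Qed.

Program Definition snd_functor (C D : category) : functor (prod_cat C D) D :=
  @Functor (prod_cat C D) D (fun p => p.2) (fun p q f => f.2) _ _.

Program Definition id_functor (C : category) : functor C C :=
  @Functor C C (fun a => a) (fun a b f => f) _ _.

Program Definition prod_functor (C D C' D' : category)
    (F : functor C C') (G : functor D D') :
    functor (prod_cat C D) (prod_cat C' D') :=
  @Functor (prod_cat C D) (prod_cat C' D') (fun p => (F p.1, G p.2))
    (fun p q f => (fhom F f.1, fhom G f.2)) _ _.
Next Obligation. by rewrite !fhom1. Qed.
Next Obligation. by rewrite !fhomM. Qed.

Program Definition full_sub (C : category) (P : C -> Prop) : category :=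
  @Category {a : C | P a} (fun a b => @mor C (sval a) (sval b))
    (fun a => idmor (sval a)) (fun a b c g f => g \oc f) _ _ _.
Next Obligation. by rewrite cmp1m. Qed.
Next Obligation. by rewrite cmpm1. Qed.
Next Obligation. by rewrite cmpA. Qed.

Program Definition corestrict (C D : category) (P : D -> Prop)
    (F : functor C D) (FP : forall a, P (F a)) : functor C (full_sub P) :=
  @Functor C (full_sub P) (fun a => exist P (F a) (FP a))
    (fun a b f => fhom F f) _ _.
Next Obligation. by rewrite fhom1. Qed.
Next Obligation. by rewrite fhomM. Qed.

Section comma.
Variables (A B C : category) (F : functor A C) (G : functor B C).

Record comma_obj := CommaObj {
  comma_l : A; comma_r : B; comma_arrow : mor (F comma_l) (G comma_r) }.

Record comma_hom (x y : comma_obj) := CommaHom {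
  comma_hl : mor (comma_l x) (comma_l y);
  comma_hr : mor (comma_r x) (comma_r y);
  comma_comm : comma_arrow y \oc fhom F comma_hl =
               fhom G comma_hr \oc comma_arrow x }.

Lemma comma_hom_eq (x y : comma_obj) (f g : comma_hom x y) :
  comma_hl f = comma_hl g -> comma_hr f = comma_hr g -> f = g.
Proof.
case: f g => [f1 f2 fE] [g1 g2 gE] /= e1 e2; subst g1 g2.
by congr CommaHom; exact: Prop_irrelevance.
Qed.

Program Definition comma_id (x : comma_obj) : comma_hom x x :=
  @CommaHom x x (idmor _) (idmor _) _.
Next Obligation. by rewrite !fhom1 cmp1m cmpm1. Qed.

Program Definition comma_cmp (x y z : comma_obj)
    (g : comma_hom y z) (f : comma_hom x y) : comma_hom x z :=
  @CommaHom x z (comma_hl g \oc comma_hl f) (comma_hr g \oc comma_hr f) _.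
Next Obligation.
by rewrite !fhomM cmpA comma_comm -cmpA comma_comm cmpA.
Qed.

Program Definition comma_cat : category :=
  @Category comma_obj comma_hom comma_id comma_cmp _ _ _.
Next Obligation. by apply: comma_hom_eq => /=; rewrite cmp1m. Qed.
Next Obligation. by apply: comma_hom_eq => /=; rewrite cmpm1. Qed.
Next Obligation. by apply: comma_hom_eq => /=; rewrite cmpA. Qed.

Program Definition comma_pr_l : functor comma_cat A :=
  @Functor comma_cat A comma_l (fun x y f => comma_hl f) _ _.

Program Definition comma_pr_r : functor comma_cat B :=
  @Functor comma_cat B comma_r (fun x y f => comma_hr f) _ _.
End comma.

Program Definition SetCat : category :=
  @Category Type (fun X Y => X -> Y) (fun X x => x)
    (fun X Y Z g f x => g (f x)) _ _ _.

(* [measurableType] is pointed; measurable spaces are redefined here because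
   the objects of Meas include the empty space. *)
Record mspace := MSpace {
  mcarrier :> Type;
  events : set (set mcarrier);
  events_sigma : sigma_algebra setT events }.
Arguments events : clear implicits.

Definition mspace_of d (T : measurableType d) : mspace :=
  @MSpace T measurable (sigma_algebra_measurable T).

Definition measurable_map (X Y : mspace) (f : X -> Y) :=
  forall B, events Y B -> events X (f @^-1` B).

Record mmap (X Y : mspace) := MMap {
  mmap_fun :> X -> Y;
  mmap_meas : measurable_map mmap_fun }.

Lemma mmap_eq (X Y : mspace) (f g : mmap X Y) : f =1 g -> f = g.
Proof.
case: f g => [f fm] [g gm] /= /funext e; subst g.
by congr MMap; exact: Prop_irrelevance.
Qed.

Program Definition Meas : category :=
  @Category mspace mmap (fun X => @MMap X X (fun x => x) _)
    (fun X Y Z g f => @MMap X Z (fun x => g (f x)) _) _ _ _.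
Next Obligation. by move=> B. Qed.
Next Obligation.
by move=> B mB; have := mmap_meas f (mmap_meas g mB).
Qed.
Next Obligation. by apply: mmap_eq => x. Qed.
Next Obligation. by apply: mmap_eq => x. Qed.
Next Obligation. by apply: mmap_eq => x. Qed.

Program Definition forget : functor Meas SetCat :=
  @Functor Meas SetCat mcarrier (fun X Y f => mmap_fun f) _ _.

Definition discrete (X : mspace) := forall A, events X A.

Definition finite_discrete (X : mspace) :=
  finite_set [set: X] /\ discrete X.

Section probability_measures.
Variable R : realType.

Definition is_probability (X : mspace) (P : set X -> \bar R) :=
  [/\ P set0 = 0,
      forall A, events X A -> 0 <= P A,
      forall F : (set X)^nat, (forall i, events X (F i)) -> trivIset setT F ->
        P (\bigcup_i F i) = \sum_(i <oo) P (F i) &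
      P setT = 1].

(* As in the library, [P] is a total function on [set X]; the last field fixes
   its junk values, so that Leibniz equality in [prob X] is equality of measures
   on the sigma-algebra. *)
Record prob (X : mspace) := Prob {
  prob_fun :> set X -> \bar R;
  prob_is_probability : is_probability prob_fun;
  prob_junk : forall A, ~ events X A -> prob_fun A = 0 }.

Lemma prob_eq (X : mspace) (P Q : prob X) :
  (forall A, events X A -> P A = Q A) -> P = Q.
Proof.
case: P Q => [P hP jP] [Q hQ jQ] /= PQ.
have {}PQ : P = Q.
  apply/funext => A; have [/PQ//|nA] := pselect (events X A).
  by rewrite jP// jQ.
by subst Q; congr Prob; exact: Prop_irrelevance.
Qed.

Section events_lemmas.
Variable X : mspace.

Lemma events0 : events X set0. Proof. by have [] := events_sigma X. Qed.

Lemma eventsC A : events X A -> events X (~` A).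
Proof. by have [_ + _] := events_sigma X => /[apply]; rewrite setTD. Qed.

Lemma events_bigcup (F : (set X)^nat) :
  (forall i, events X (F i)) -> events X (\bigcup_i F i).
Proof. by have [_ _] := events_sigma X; exact. Qed.

Lemma eventsT : events X setT.
Proof. by rewrite -setC0; exact/eventsC/events0. Qed.
End events_lemmas.

Definition on_events (X : mspace) (P : set X -> \bar R) : set X -> \bar R :=
  fun A => if `[< events X A >] then P A else 0.

Lemma on_eventsE (X : mspace) (P : set X -> \bar R) A :
  events X A -> on_events P A = P A.
Proof. by move=> mA; rewrite /on_events asboolT. Qed.

Program Definition mk_prob (X : mspace) (P : set X -> \bar R)
  (hP : is_probability P) : prob X := @Prob X (on_events P) _ _.
Next Obligation.
case: hP => P0 Pge0 Psig PT; split.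
- by rewrite on_eventsE//; exact: events0.
- by move=> A mA; rewrite on_eventsE//; exact: Pge0.
- move=> F mF tF; rewrite on_eventsE; last exact: events_bigcup.
  by rewrite Psig//; apply: eq_eseriesr => i _; rewrite on_eventsE.
- by rewrite on_eventsE//; exact: eventsT.
Qed.
Next Obligation. by rewrite /on_events asboolF. Qed.

(* A space carrying a probability measure is nonempty, hence becomes a (pointed)
   [measurableType], over which the library integral is available. *)
Definition mnonempty (X : mspace) := exists x : X, True.

Lemma prob_nonempty (X : mspace) (P : prob X) : mnonempty X.
Proof.
apply: contrapT => nX; have [P0 _ _ PT] := prob_is_probability P.
have : (0 : \bar R) = 1.
  rewrite -P0 -PT; congr (P _); apply/esym; rewrite -subset0 => x _.
  by apply: nX; exists x.
by move=> [] /eqP; rewrite eq_sym oner_eq0.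
Qed.

Definition pointed_mspace (X : mspace) (h : mnonempty X) : Type := X.

HB.instance Definition _ X h := gen_eqMixin (@pointed_mspace X h).
HB.instance Definition _ X h := gen_choiceMixin (@pointed_mspace X h).
HB.instance Definition _ X h :=
  isPointed.Build (@pointed_mspace X h) (projT1 (cid h)).
HB.instance Definition _ X h :=
  @isMeasurable.Build (sigma_display (events X)) (@pointed_mspace X h)
    (events X) (events0 X) (@eventsC X) (@events_bigcup X).

Definition prob_measure (X : mspace) (h : mnonempty X) (P : prob X) :
  set (pointed_mspace h) -> \bar R := P.
Arguments prob_measure {X} h P.

Section prob_measure_instance.
Variables (X : mspace) (h : mnonempty X) (P : prob X).

Let P0 : prob_measure h P set0 = 0.
Proof. by case: (prob_is_probability P). Qed.

Let P_ge0 A : 0 <= prob_measure h P A.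
Proof.
have [_ Pge0 _ _] := prob_is_probability P.
have [/Pge0//|nA] := pselect (events X A).
by rewrite /prob_measure prob_junk.
Qed.

Let P_sigma : semi_sigma_additive (prob_measure h P).
Proof.
move=> F mF tF _; have [_ _ Psig _] := prob_is_probability P.
rewrite /prob_measure Psig//.
by apply: is_cvg_nneseries => n _ _; exact: P_ge0.
Qed.

HB.instance Definition _ :=
  isMeasure.Build _ _ _ (prob_measure h P) P0 P_ge0 P_sigma.

Let PT : prob_measure h P setT = 1.
Proof. by case: (prob_is_probability P). Qed.

HB.instance Definition _ := Measure_isProbability.Build _ _ _
  (prob_measure h P) PT.
End prob_measure_instance.

Definition prob_integral (X : mspace) (P : prob X) (f : X -> \bar R) : \bar R :=
  \int[prob_measure (prob_nonempty P) P]_(x in setT) f x.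

Lemma prob_integralE (X : mspace) (h : mnonempty X) (P : prob X) f :
  prob_integral P f = \int[prob_measure h P]_x f x.
Proof. by rewrite /prob_integral (Prop_irrelevance (prob_nonempty P) h). Qed.

Definition ereal_mspace : mspace := mspace_of (\bar R).

Lemma measurable_mapE (X : mspace) (h : mnonempty X) (f : X -> \bar R) :
  measurable_map (f : X -> ereal_mspace) <->
  measurable_fun [set: pointed_mspace h] f.
Proof.
split=> mf; first by move=> _ B mB; rewrite setTI; exact: mf.
by move=> B mB; rewrite -[X in events _ X]setTI; exact: mf.
Qed.

Record markov_kernel (X Y : mspace) := MarkovKernel {
  kernel_fun :> X -> prob Y;
  kernel_meas : forall B, events Y B ->
    measurable_map (fun x => kernel_fun x B : ereal_mspace) }.

Lemma kernel_eq (X Y : mspace) (k l : markov_kernel X Y) : k =1 l -> k = l.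
Proof.
case: k l => [k km] [l lm] /= /funext e; subst l.
by congr MarkovKernel; exact: Prop_irrelevance.
Qed.

Definition deterministic (X Y : mspace) (k : markov_kernel X Y) :=
  forall (x : X) (B : set Y), events Y B -> k x B = 0 \/ k x B = 1.

Lemma pushforward_is_probability (X Y : mspace) (f : mmap X Y) (P : prob X) :
  is_probability (fun B : set Y => P (f @^-1` B)).
Proof.
case: (prob_is_probability P) => P0 Pge0 Psig PT; split.
- by rewrite preimage_set0.
- by move=> B mB; apply/Pge0/mmap_meas.
- move=> F mF tF; rewrite preimage_bigcup Psig//.
    by move=> i; exact: mmap_meas.
  apply/trivIsetP => i j _ _ ij; rewrite -preimage_setI.
  by move/trivIsetP : tF => ->//; rewrite preimage_set0.
- by rewrite preimage_setT.
Qed.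

Definition prob_pushforward (X Y : mspace) (f : mmap X Y) (P : prob X) :
    prob Y :=
  mk_prob (pushforward_is_probability f P).

Program Definition ProbFunctor : functor Meas SetCat :=
  @Functor Meas SetCat prob prob_pushforward _ _.
Next Obligation.
by apply/funext => P; apply: prob_eq => A mA /=; rewrite on_eventsE.
Qed.
Next Obligation.
apply/funext => P; apply: prob_eq => A mA /=; rewrite !on_eventsE//.
exact: mmap_meas.
Qed.

Lemma dirac_is_probability (X : mspace) (x : X) :
  is_probability (fun A : set X => (\1_A x)%:E : \bar R).
Proof.
have h : mnonempty X by exists x.
split.
- exact: (@measure0 _ _ _ (@dirac _ (pointed_mspace h) x R)).
- by move=> A _; rewrite lee_fin.
- move=> F mF tF; apply/esym/cvg_lim => //.
  apply: (@measure_semi_sigma_additive _ _ _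
    (@dirac _ (pointed_mspace h) x R)) => //.
  exact: events_bigcup.
- by rewrite indicT.
Qed.

Definition dirac_prob (X : mspace) (x : X) : prob X :=
  mk_prob (dirac_is_probability x).

Lemma dirac_probE (X : mspace) (x : X) A :
  events X A -> dirac_prob x A = (\1_A x)%:E.
Proof. exact: on_eventsE. Qed.

Lemma kcmp_is_probability (X Y Z : mspace)
    (l : markov_kernel Y Z) (k : markov_kernel X Y) (x : X) :
  is_probability (fun C : set Z => prob_integral (k x) (fun y => l y C)).
Proof.
have h := prob_nonempty (k x).
have lm C : events Z C -> measurable_fun [set: pointed_mspace h] (l ^~ C).
  by move=> mC; exact/measurable_mapE/kernel_meas.
have l_ge0 y C : 0 <= l y C.
  exact: (@measure_ge0 _ _ _ (prob_measure (prob_nonempty (l y)) (l y))).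
split.
- rewrite (prob_integralE h) integral0_eq// => y _.
  by case: (prob_is_probability (l y)).
- by move=> A _; rewrite (prob_integralE h) integral_ge0.
- move=> F mF tF; rewrite (prob_integralE h).
  under eq_integral.
    move=> y _.
    have [_ _ -> // _] := prob_is_probability (l y).
    over.
  rewrite integral_nneseries//; last by move=> n; exact: lm.
  by apply: eq_eseriesr => n _; rewrite (prob_integralE h).
- rewrite (prob_integralE h).
  under eq_integral.
    move=> y _.
    have [_ _ _ ->] := prob_is_probability (l y).
    over.
  by rewrite integral_cst//= mul1e; case: (prob_is_probability (k x)).
Qed.

Lemma kdelta_meas (X Y : mspace) (f : mmap X Y) B : events Y B ->
  measurable_map (fun x => dirac_prob (f x) B : ereal_mspace).
Proof.
move=> mB.
have [h|nX] := pselect (mnonempty X); last first.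
  move=> U mU; rewrite (_ : _ @^-1` _ = set0); first exact: events0.
  by rewrite -subset0 => x _; apply: nX; exists x.
apply/(measurable_mapE h) => _ U mU; rewrite setTI.
rewrite (_ : _ @^-1` _ =
  (EFin \o (\1_(f @^-1` B : set (pointed_mspace h)) : _ -> R)) @^-1` U).
  rewrite -[X in measurable X]setTI.
  apply: (@measurable_funTS _ _ _ _ setT) => //.
  apply/measurable_EFinP; apply: measurable_indic.
  exact: mmap_meas.
by apply/seteqP; split => x /=; rewrite on_eventsE// !indicE.
Qed.

Definition kdelta (X Y : mspace) (f : mmap X Y) : markov_kernel X Y :=
  @MarkovKernel X Y (fun x => dirac_prob (f x)) (kdelta_meas f).

Lemma mnonempty_map (X : mspace) (f : X -> ereal_mspace) :
  (mnonempty X -> measurable_map f) -> measurable_map f.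
Proof.
have [h|nX _] := pselect (mnonempty X); first exact.
move=> U mU; rewrite (_ : _ @^-1` _ = set0); first exact: events0.
by rewrite -subset0 => x _; apply: nX; exists x.
Qed.

Definition lib_kernel (X Y : mspace) (hX : mnonempty X) (hY : mnonempty Y)
    (k : markov_kernel X Y) :
    pointed_mspace hX -> {measure set (pointed_mspace hY) -> \bar R} :=
  fun x => prob_measure hY (k x).
Arguments lib_kernel {X Y} hX hY k.

Section lib_kernel_instance.
Variables (X Y : mspace) (hX : mnonempty X) (hY : mnonempty Y).
Variable k : markov_kernel X Y.

Let km U : measurable U -> measurable_fun [set: _] (lib_kernel hX hY k ^~ U).
Proof. by move=> mU; exact/measurable_mapE/kernel_meas. Qed.

HB.instance Definition _ := isKernel.Build _ _ _ _ R (lib_kernel hX hY k) km.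

Let kT x : lib_kernel hX hY k x setT = 1.
Proof. exact: probability_setT. Qed.

HB.instance Definition _ :=
  Kernel_isProbability.Build _ _ _ _ R (lib_kernel hX hY k) kT.
End lib_kernel_instance.

Lemma kernel_ge0 (X Y : mspace) (k : markov_kernel X Y) x B : 0 <= k x B.
Proof.
exact: (@measure_ge0 _ _ _ (prob_measure (prob_nonempty (k x)) (k x))).
Qed.

Lemma kcmp_meas (X Y Z : mspace)
    (l : markov_kernel Y Z) (k : markov_kernel X Y) C :
  events Z C ->
  measurable_map
    (fun x => mk_prob (kcmp_is_probability l k x) C : ereal_mspace).
Proof.
move=> mC; apply: mnonempty_map => hX.
have hY : mnonempty Y by have [x _] := hX; exact: prob_nonempty (k x).
apply/(measurable_mapE hX).
rewrite [X in measurable_fun _ X](_ : _ =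
    (fun x => \int[lib_kernel hX hY k x]_y l y C)); last first.
  by apply/funext => x /=; rewrite on_eventsE// (prob_integralE hY).
apply: measurable_fun_integral_kernel.
- by move=> U mU; exact: measurable_kernel.
- by move=> y; exact: kernel_ge0.
- exact/measurable_mapE/kernel_meas.
Qed.

Definition kcmp (X Y Z : mspace)
    (l : markov_kernel Y Z) (k : markov_kernel X Y) : markov_kernel X Z :=
  @MarkovKernel X Z (fun x => mk_prob (kcmp_is_probability l k x))
    (kcmp_meas l k).

Lemma kcmpE (X Y Z : mspace)
    (l : markov_kernel Y Z) (k : markov_kernel X Y) x C :
  events Z C -> kcmp l k x C = prob_integral (k x) (fun y => l y C).
Proof. exact: on_eventsE. Qed.

Lemma prob_integral_dirac (X : mspace) (x : X) (f : X -> ereal_mspace) :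
  measurable_map f -> prob_integral (dirac_prob x) f = f x.
Proof.
have h : mnonempty X by exists x.
move=> /(measurable_mapE h) mf; rewrite (prob_integralE h).
rewrite (@eq_measure_integral _ _ _ _ (@dirac _ (pointed_mspace h) x R)).
  by rewrite integral_dirac// diracT mul1e.
by move=> A mA _; exact: dirac_probE.
Qed.

Definition kid (X : mspace) : markov_kernel X X := kdelta (idmor (X : Meas)).

Lemma kcmp1m (X Y : mspace) (k : markov_kernel X Y) : kcmp (kid Y) k = k.
Proof.
apply: kernel_eq => x; apply: prob_eq => B mB; rewrite kcmpE//.
have h := prob_nonempty (k x).
rewrite (prob_integralE h).
under eq_integral do rewrite /= on_eventsE//.
by rewrite (@integral_indic _ (pointed_mspace h)) ?setIT.
Qed.

Lemma kcmpm1 (X Y : mspace) (k : markov_kernel X Y) : kcmp k (kid X) = k.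
Proof.
apply: kernel_eq => x; apply: prob_eq => B mB; rewrite kcmpE//=.
by rewrite prob_integral_dirac//; exact: kernel_meas.
Qed.

Lemma kcmpA (W X Y Z : mspace)
    (m : markov_kernel Y Z) (l : markov_kernel X Y) (k : markov_kernel W X) :
  kcmp m (kcmp l k) = kcmp (kcmp m l) k.
Proof.
apply: kernel_eq => w; apply: prob_eq => C mC; rewrite !kcmpE//.
have hW : mnonempty W by exists w.
have hX := prob_nonempty (k w).
have hY := prob_nonempty (kcmp l k w).
have mf : measurable_fun [set: pointed_mspace hY] (m ^~ C).
  exact/measurable_mapE/kernel_meas.
rewrite (prob_integralE hY) (prob_integralE hX).
pose l' := mathcomp.analysis.kernel.kernel_snd (lib_kernel hX hY l) :
  (pointed_mspace hW * _) -> _.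
have := @integral_kcomp _ _ _ _ _ _ _ (lib_kernel hW hX k) l' w (m ^~ C)
  (fun y => kernel_ge0 m y C) mf.
move=> kE.
transitivity (\int[kcomp (lib_kernel hW hX k) l' w]_y m y C).
  apply: eq_measure_integral => A mA _.
  by apply: (etrans (kcmpE l k w mA)); rewrite (prob_integralE hX).
rewrite kE; apply: eq_integral => x _.
by rewrite kcmpE// (prob_integralE hY).
Qed.

Definition Stoch : category :=
  @Category mspace markov_kernel kid kcmp kcmp1m kcmpm1 kcmpA.

Program Definition delta : functor Meas Stoch :=
  @Functor Meas Stoch (fun X => X) kdelta _ _.
Next Obligation.
apply: kernel_eq => x; apply: prob_eq => C mC.
rewrite kcmpE// prob_integral_dirac; last exact: kdelta_meas.
by [].
Qed.

Definition FinStoch : category := full_sub (finite_discrete : Stoch -> Prop).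

End probability_measures.
Arguments prob_measure {R X} h P.
Arguments lib_kernel {R X Y} hX hY k.

Record design_data := DesignData {
  dU : category;
  dOmega : category;
  dV : category;
  dGamma : functor (prod_cat dV (op dU)) Meas;
  dC : category;
  dJU : functor dU dC;
  dJOmega : functor dOmega dC;
  dK : category;
  dUK : functor dK SetCat;
  dUK_faithful : faithful_functor dUK;
  dTheta : functor (op dOmega) dK }.

Section models.
Variables (R : realType) (D : design_data).

Definition designs : category := comma_cat (dJU D) (dJOmega D).
Definition prU : functor designs (dU D) := comma_pr_l (dJU D) (dJOmega D).
Definition prOmega : functor designs (dOmega D) :=
  comma_pr_r (dJU D) (dJOmega D).

(* (v, (u, w, x)) |-> w *)
Definition to_covariate :
    functor (prod_cat (dV D) (op designs)) (op (dOmega D)) :=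
  functor_comp (op_functor prOmega) (snd_functor (dV D) (op designs)).

(* (v, (u, w, x)) |-> Gamma (v, u) *)
Definition to_sample : functor (prod_cat (dV D) (op designs)) Meas :=
  functor_comp (dGamma D) (prod_functor (id_functor (dV D)) (op_functor prU)).

Definition param_set : functor (op (dOmega D)) SetCat :=
  functor_comp (dUK D) (dTheta D).

Definition L_set : functor (prod_cat (dV D) (op designs)) SetCat :=
  functor_comp param_set to_covariate.

Definition R_set : functor (prod_cat (dV D) (op designs)) SetCat :=
  functor_comp (ProbFunctor R) to_sample.

Definition statistical_model := nat_trans L_set R_set.

Variable Theta_Meas : functor (op (dOmega D)) Meas.

Definition L_stoch : functor (prod_cat (dV D) (op designs)) (Stoch R) :=
  functor_comp (delta R) (functor_comp Theta_Meas to_covariate).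

Definition R_stoch : functor (prod_cat (dV D) (op designs)) (Stoch R) :=
  functor_comp (delta R) to_sample.

Definition lifts_param := functor_comp forget Theta_Meas = param_set.

Variable lift : lifts_param.

Definition param_cast (w : dOmega D) (theta : Theta_Meas w) : param_set w :=
  eq_rect (functor_comp forget Theta_Meas)
    (fun F : functor (op (dOmega D)) SetCat => F w) theta param_set lift.

Definition measurable_in_parameter (P : statistical_model) :=
  forall (v : dV D) (d : designs) (E : set (dGamma D (v, prU d))),
    events (dGamma D (v, prU d)) E ->
    measurable_map (fun theta : Theta_Meas (prOmega d) =>
      P (v, d) (param_cast theta) E : ereal_mspace R).

(* The categories of units, covariate spaces and response scales are abstract;
   the underlying sets of their objects are given by SU, SOmega and SV. *)
Record finite_design (SU : functor (dU D) SetCat)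
    (SOmega : functor (dOmega D) SetCat) (SV : functor (dV D) SetCat) := {
  finite_units : forall u, finite_set [set: SU u];
  finite_covariates : forall w, finite_set [set: SOmega w];
  finite_scales : forall v, finite_set [set: SV v];
  finite_samples : forall v u, finite_discrete (dGamma D (v, u));
  finite_params : forall w, finite_set [set: param_set w] }.

End models.
Arguments prU {D}.
Arguments prOmega {D}.

(* Main.v *)
Require Import Defs.
From HB Require Import structures.
From mathcomp Require Import all_boot all_order all_algebra.
From mathcomp Require Import all_classical all_reals all_analysis.

Set Implicit Arguments.
Unset Strict Implicit.
Unset Printing Implicit Defensive.

(** The functor [delta] is the Kleisli inclusion of the Giry monad. Composing
    a kernel [k] after [delta f] reindexes it along [f], and composing
    [delta g] after [k] pushes every measure [k x] forward along [g]
    ([kcmp_kdeltar], [kcmp_kdeltal]). Evaluated at a parameter, a naturality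
    square in Stoch between functors that factor through [delta] is therefore
    literally a naturality square in Set for maps into the sets of probability
    measures ([kdelta_squareP]). So a statistical model and a transformation
    of kernels consist of the same data subject to the same equations; the only
    thing a kernel has in addition is measurability in the parameter. This
    gives the bijection (i), and (ii) holds because Dirac measures are
    0/1-valued.

    In the finite case every map out of a discrete parameter space is
    measurable, so the condition in (i) is automatic; and as FinStoch is a full
    subcategory, transformations between functors with values in it are the
    transformations between the underlying functors to Stoch
    ([corestrict_nat]).

    The lift of the parameter functor is an equality of functors to Set, not a
    definitional identity, so parameters are transported between
    the carriers of [Theta_Meas] and the parameter sets; this transport is a
    natural bijection ([transport_natural], [transportK]). *)

Local Open Scope classical_set_scope.

(** * Natural transformations *)

Lemma nat_trans_eq (C E : category) (F G : functor C E) (s t : nat_trans F G) :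
  (forall a, s a = t a) -> s = t.
Proof.
case: s t => [s sN] [t tN] /= st.
have {}st : s = t by exact: functional_extensionality_dep.
by subst t; congr NatTrans; exact: Prop_irrelevance.
Qed.

Section corestriction.
Variables (C E : category) (P : E -> Prop) (F G : functor C E).
Variables (FP : forall a, P (F a)) (GP : forall a, P (G a)).

Definition corestrict_nat (t : nat_trans F G) :
    nat_trans (corestrict FP) (corestrict GP) :=
  @NatTrans _ _ (corestrict FP) (corestrict GP) t (naturality t).

Definition uncorestrict_nat (t : nat_trans (corestrict FP) (corestrict GP)) :
    nat_trans F G :=
  @NatTrans _ _ F G (fun a => t a) (fun a b f => naturality t f).

Lemma corestrict_nat_bij : bijective corestrict_nat.
Proof. by exists uncorestrict_nat => t; exact: nat_trans_eq. Qed.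
End corestriction.

(** Eliminating the equality of functors turns the transport into the identity,
    for which bijectivity and naturality are trivial. *)
Section transport.
Variables (C : category) (F G : functor C SetCat) (e : F = G).

Definition transport (a : C) (x : F a) : G a :=
  eq_rect F (fun H : functor C SetCat => H a) x G e.

Definition transport_inv (a : C) (y : G a) : F a :=
  eq_rect G (fun H : functor C SetCat => H a) y F (esym e).

Lemma transportK (a : C) : cancel (@transport a) (@transport_inv a).
Proof. by rewrite /transport /transport_inv; case: _ / e. Qed.

Lemma transport_invK (a : C) : cancel (@transport_inv a) (@transport a).
Proof. by rewrite /transport /transport_inv; case: _ / e. Qed.

Lemma transport_natural (a b : C) (f : mor a b) (x : F a) :
  transport (fhom F f x) = fhom G f (transport x).
Proof. by rewrite /transport; case: _ / e. Qed.
End transport.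

(** * Composition with deterministic kernels *)

Section dirac_kernels.
Variable R : realType.

Lemma kdelta_deterministic (X Y : mspace) (f : mmap X Y) :
  deterministic (kdelta R f).
Proof.
move=> x B mB; rewrite /= on_eventsE// indicE.
by case: (_ \in _); [right | left].
Qed.

Lemma kcmp_kdeltar (X Y Z : mspace) (k : markov_kernel R Y Z) (f : mmap X Y)
    (x : X) : kcmp k (kdelta R f) x = k (f x).
Proof.
apply: prob_eq => C mC; rewrite kcmpE//= prob_integral_dirac//.
exact: kernel_meas.
Qed.

(** The integral of the indicator of [B] at [g y] is the mass of [g @^-1` B]. *)
Lemma kcmp_kdeltal (X Y Z : mspace) (g : mmap Y Z) (k : markov_kernel R X Y)
    (x : X) : kcmp (kdelta R g) k x = prob_pushforward g (k x).
Proof.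
apply: prob_eq => B mB; rewrite kcmpE//= on_eventsE//.
have h := prob_nonempty (k x).
rewrite (prob_integralE h).
under eq_integral do rewrite on_eventsE//.
have mgB : measurable (g @^-1` B : set (pointed_mspace h)) by exact: mmap_meas.
by have := integral_indic (prob_measure h (k x)) measurableT mgB; rewrite setIT.
Qed.

(** Both legs of the square end in a probability measure on [Y'], and Markov
    kernels are determined by their values at points, so no integral is left
    on either side. *)
Lemma kdelta_squareP (X X' Y Y' : mspace) (f : mmap X X') (g : mmap Y Y')
    (k : markov_kernel R X Y) (l : markov_kernel R X' Y') :
  kcmp (kdelta R g) k = kcmp l (kdelta R f) <->
  forall x, prob_pushforward g (k x) = l (f x).
Proof.
split=> [kl x|kl]; first by rewrite -kcmp_kdeltal kl kcmp_kdeltar.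
by apply: kernel_eq => x; rewrite kcmp_kdeltal kl kcmp_kdeltar.
Qed.
End dirac_kernels.

(** * Models as natural transformations of kernels *)

Section model_kernels.
Variables (R : realType) (D : design_data).
Variables (Theta_Meas : functor (op (dOmega D)) Meas).
Variable lift : lifts_param Theta_Meas.

Local Notation model := (statistical_model R D).
Local Notation measurable_model :=
  {P : model | measurable_in_parameter lift P}.
Local Notation kernel_nat := (nat_trans (L_stoch R Theta_Meas) (R_stoch R D)).

Definition param_uncast (w : dOmega D) (y : param_set D w) : Theta_Meas w :=
  transport_inv lift y.

Lemma param_castK w : cancel (@param_cast _ _ lift w) (@param_uncast w).
Proof. exact: (transportK lift). Qed.

Lemma param_uncastK w : cancel (@param_uncast w) (@param_cast _ _ lift w).
Proof. exact: (transport_invK lift). Qed.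

Lemma param_cast_natural (w w' : dOmega D) (f : mor w w')
    (theta : Theta_Meas w') :
  param_cast lift (fhom Theta_Meas (f : @mor (op (dOmega D)) w' w) theta) =
  fhom (param_set D) (f : @mor (op (dOmega D)) w' w) (param_cast lift theta).
Proof. exact: (transport_natural lift). Qed.

(** Measurability in the parameter is stated at explicit pairs, so the object
    is destructed to make the types of the kernel agree with it. *)
Definition model_kernel (P : measurable_model) a :
    markov_kernel R (L_stoch R Theta_Meas a) (R_stoch R D a) :=
  let: (v, d) := a in
  MarkovKernel (kernel_fun := fun theta : Theta_Meas (prOmega d) =>
                  sval P (v, d) (param_cast lift theta))
    (fun B mB => svalP P v d B mB).

Lemma model_kernelE (P : measurable_model) a
    (theta : Theta_Meas (prOmega a.2)) :
  model_kernel P a theta = sval P a (param_cast lift theta).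
Proof. by case: a theta. Qed.

Lemma model_kernel_natural (P : measurable_model) a b (m : mor a b) :
  fhom (R_stoch R D) m \oc (model_kernel P a : mor (L_stoch R Theta_Meas a) _) =
  (model_kernel P b : mor (L_stoch R Theta_Meas b) _) \oc
    fhom (L_stoch R Theta_Meas) m.
Proof.
apply/kdelta_squareP => theta; rewrite !model_kernelE.
have /(congr1 (fun h => h (param_cast lift theta))) := naturality (sval P) m.
move=> /= ->; congr (sval P b _).
exact/esym/(param_cast_natural (comma_hr m.2)).
Qed.

Definition kernels_of_model (P : measurable_model) : kernel_nat :=
  @NatTrans _ _ (L_stoch R Theta_Meas) (R_stoch R D) (model_kernel P)
    (@model_kernel_natural P).

(** The component seen as a kernel rather than as a morphism of the category
    Stoch, so that it can be applied to parameters. *)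
Definition kernel_component (N : kernel_nat) a :
    markov_kernel R (L_stoch R Theta_Meas a) (R_stoch R D a) := N a.

Lemma model_of_kernels_natural (N : kernel_nat) a b (m : mor a b) :
  fhom (R_set R D) m \oc
    ((fun y => kernel_component N a (param_uncast y)) : mor (L_set D a) _) =
  ((fun y => kernel_component N b (param_uncast y)) : mor (L_set D b) _) \oc
    fhom (L_set D) m.
Proof.
apply/funext => y /=.
have /kdelta_squareP -> := naturality N m.
congr (kernel_component N b _); apply: (can_inj (@param_castK _)).
rewrite param_uncastK.
by rewrite [LHS](param_cast_natural (comma_hr m.2)) param_uncastK.
Qed.

Definition model_of_kernels (N : kernel_nat) : model :=
  @NatTrans _ _ (L_set D) (R_set R D)
    (fun a y => kernel_component N a (param_uncast y))
    (@model_of_kernels_natural N).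

Lemma model_of_kernels_measurable (N : kernel_nat) :
  measurable_in_parameter lift (model_of_kernels N).
Proof.
move=> v d E mE /=.
under [X in measurable_map X]funext do rewrite param_castK.
exact: (kernel_meas (kernel_component N (v, d)) mE).
Qed.

Lemma kernels_of_model_bij : bijective kernels_of_model.
Proof.
exists (fun N => exist _ (model_of_kernels N)
                   (@model_of_kernels_measurable N)) => [P|N].
  apply: eq_sig_hprop => [?|]; first exact: Prop_irrelevance.
  apply: nat_trans_eq => a; apply/funext => y /=.
  by rewrite /kernel_component model_kernelE param_uncastK.
apply: nat_trans_eq => a; apply: kernel_eq => theta.
by rewrite model_kernelE /= param_castK.
Qed.

Lemma discrete_measurable_in_parameter (P : model) :
  (forall w, discrete (Theta_Meas w)) -> measurable_in_parameter lift P.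
Proof. by move=> disc v d E mE B mB; exact: disc. Qed.

Lemma finite_param_carrier (w : dOmega D) :
  finite_set [set: param_set D w] -> finite_set [set: Theta_Meas w].
Proof.
move=> /(finite_image (@param_uncast w)); apply: sub_finite_set => theta _.
by exists (param_cast lift theta) => //; exact: param_castK.
Qed.
End model_kernels.

Theorem theorem1p1 (R : realType) (D : design_data)
    (Theta_Meas : functor (op (dOmega D)) Meas)
    (lift : lifts_param Theta_Meas) :
  [/\ exists Phi :
          {P : statistical_model R D | measurable_in_parameter lift P} ->
          nat_trans (L_stoch R Theta_Meas) (R_stoch R D),
        (forall P (v : dV D) (d : designs D) (theta : Theta_Meas (prOmega d)),
           (Phi P (v, d) : markov_kernel _ _ _) theta =
           sval P (v, d) (param_cast lift theta)) /\
        bijective Phi,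
      (forall (a b : prod_cat (dV D) (op (designs D))) (m : mor a b),
         deterministic (fhom (L_stoch R Theta_Meas) m) /\
         deterministic (fhom (R_stoch R D) m)) &
      forall (SU : functor (dU D) SetCat) (SOmega : functor (dOmega D) SetCat)
        (SV : functor (dV D) SetCat),
      finite_design SU SOmega SV ->
      (forall w, discrete (Theta_Meas w)) ->
      (forall P : statistical_model R D, measurable_in_parameter lift P) /\
      exists (hL : forall a, finite_discrete (L_stoch R Theta_Meas a))
             (hR : forall a, finite_discrete (R_stoch R D a))
             (Phi : statistical_model R D ->
                nat_trans
                  (corestrict hL : functor _ (FinStoch R))
                  (corestrict hR : functor _ (FinStoch R))),
        (forall P (v : dV D) (d : designs D) (theta : Theta_Meas (prOmega d)),
           (Phi P (v, d) : markov_kernel _ _ _) theta =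
           P (v, d) (param_cast lift theta)) /\
        bijective Phi].
Proof.
split.
- exists (kernels_of_model (lift := lift)).
  by split; last exact: kernels_of_model_bij.
- by move=> a b m; split; exact: kdelta_deterministic.
- move=> SU SOmega SV fin disc.
  have meas (P : statistical_model R D) : measurable_in_parameter lift P.
    exact: discrete_measurable_in_parameter.
  have hL a : finite_discrete (L_stoch R Theta_Meas a).
    split; last exact: disc.
    exact/(finite_param_carrier lift)/(finite_params fin).
  have hR a : finite_discrete (R_stoch R D a) by exact: (finite_samples fin).
  split=> //; exists hL, hR.
  exists (fun P => corestrict_nat hL hR (kernels_of_model (exist _ P (meas P)))).
  split=> //.
  apply: (bij_comp (corestrict_nat_bij hL hR)).
  apply: (bij_comp (kernels_of_model_bij R lift)).
  (* [meas] makes the measurable models all of the models. *)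
  exists sval => [//|[P hP]].
  by apply: eq_sig_hprop => [?|] //; exact: Prop_irrelevance.
Qed.
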